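(* Let $d\ge 1$ and let $\|\cdot\|$ be any norm on $\mathbb{R}^d$, used to define the balls, the annuli and the sets $E_\mu(\delta,\eta)$. Let $\mu$ be a Radon probability measure on $\mathbb{R}^d$ such that $\underline{\dim}(\mu) > d-1$. Then for every $\delta> \dfrac{\overline{\dim}(\mu) -(d-1)}{\underline{\dim}(\mu) -(d-1)}$ and every $\eta \in (0,1]$, one has $\mu\big(E_\mu(\delta,\eta)\big) =0$.
   Context: For the given norm on $\mathbb{R}^d$, $B(x,r)=\{y\in\mathbb{R}^d:\|x-y\|\le r\}$ is the closed ball. For $x\in \mathbb{R}^d$, $0<r<1$ and $\delta \geq 1$, the annulus is $A(x,r,\delta) = B (x,r)\setminus B (x,r-r^\delta)$. One says that $P_{\mu}(x,r,\delta,\eta)$ holds when $\mu(A (x,r,\delta)) \geq \eta\, \mu(B(x,r))$. One sets $E_{\mu}(\delta,\eta) = \{x\in \mathbb{R}^d: P_{\mu}(x,r_n,\delta,\eta)$ holds for every $n$, for some sequence of radii $(r_n)_{n\geq 1}$ tending to $0\}$. The lower and upper dimensions of $\mu$ are $\underline{\dim}(\mu)= \sup \{\alpha\geq 0: \text{ for } \mu\text{-a.e. } x,\ \exists\, r_x>0,\ \forall\, 0<r<r_x,\ \mu(B(x,r)) \leq r^\alpha\}$ and $\overline{\dim}(\mu)= \inf \{\beta\geq 0: \text{ for } \mu\text{-a.e. } x,\ \exists\, r_x>0,\ \forall\, 0<r<r_x,\ \mu(B(x,r)) \geq r^\beta\}$. *)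

(* Defs.v *)
From HB Require Import structures.
From mathcomp Require Import all_boot all_order all_algebra.
From mathcomp Require Import all_classical all_reals all_analysis.

Set Implicit Arguments.
Unset Strict Implicit.
Unset Printing Implicit Defensive.

Import Order.TTheory GRing.Theory Num.Theory numFieldNormedType.Exports.

Local Open Scope classical_set_scope.
Local Open Scope ring_scope.

(* R^d with its Borel sigma-algebra. The topology of 'rV[R]_d is the product
   one, which is the topology of every norm on R^d. *)
Notation borel_rV R d := (g_sigma_algebraType (@open 'rV[R]_d)).

Section Definitions.
Context {R : realType} {d : nat}.
Implicit Types (mu : {measure set (borel_rV R d) -> \bar R}).
Implicit Types (N : 'rV[R]_d -> R) (x : 'rV[R]_d) (r delta eta : R).

(* An arbitrary norm, not necessarily the one `|.| that the library puts on
   'rV[R]_d; nonnegativity follows from the first two clauses. *)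
Definition is_norm N : Prop :=
  [/\ forall x y, N (x + y) <= N x + N y,
      forall (a : R) x, N (a *: x) = `|a| * N x
    & forall x, N x = 0 -> x = 0].

Definition is_radon mu : Prop :=
  (forall K : set 'rV[R]_d, compact K -> (mu K < +oo)%E) /\
  (forall A : set (borel_rV R d), measurable A ->
     mu A = ereal_sup
       [set mu K | K in [set K : set 'rV[R]_d | compact K /\ K `<=` A]]).

(* [closed_ball_ N x r] is [set y | N (x - y) <= r]. *)
Definition annulus N x r delta : set 'rV[R]_d :=
  closed_ball_ N x r `\` closed_ball_ N x (r - r `^ delta).

Definition heavy_annulus N mu x r delta eta : Prop :=
  (eta%:E * mu (closed_ball_ N x r) <= mu (annulus N x r delta))%E.

(* Annuli are only considered for radii in ]0, 1[. *)
Definition heavy_annuli_set N mu delta eta : set 'rV[R]_d :=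
  [set x | exists r_ : nat -> R,
     [/\ forall n, 0 < r_ n < 1,
         r_ n @[n --> \oo] --> (0 : R)
       & forall n, heavy_annulus N mu x (r_ n) delta eta]].

Definition lower_dim N mu : \bar R :=
  ereal_sup [set alpha%:E | alpha in [set alpha : R | 0 <= alpha /\
    {ae mu, forall x, exists2 r0 : R, 0 < r0 & forall r : R, 0 < r < r0 ->
       (mu (closed_ball_ N x r) <= (r `^ alpha)%:E)%E}]].

Definition upper_dim N mu : \bar R :=
  ereal_inf [set beta%:E | beta in [set beta : R | 0 <= beta /\
    {ae mu, forall x, exists2 r0 : R, 0 < r0 & forall r : R, 0 < r < r0 ->
       ((r `^ beta)%:E <= mu (closed_ball_ N x r))%E}]].

End Definitions.

(* Main.v *)
Require Import Defs.
From mathcomp Require Import all_boot all_order all_algebra.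
From mathcomp Require Import all_classical all_reals all_analysis.
From mathcomp Require Import measurable_realfun ring lra.

(** Write [d = n + 1] and choose [alpha] below the lower dimension and [beta]
    above the upper one, so close to them that
    [beta < n + delta * (alpha - n)]. Almost every point then satisfies
    [r `^ beta <= mu (B(x, r)) <= r `^ alpha] for all small [r].

    Suppose first that these bounds hold at all points, with a uniform range of
    radii. The annulus [A(x, r, delta)] has width [s = r `^ delta], and a
    sphere is [n]-dimensional, so about [(r / s) ^ n] balls of radius
    comparable to [s] cover the annulus. Its mass is therefore at most of
    order [(r / s) ^ n * s `^ alpha = r `^ (n + delta * (alpha - n))]
    ([thin_annulus_mass]), which for small [r] is less than any proportion of
    [r `^ beta], hence of the mass of the ball.

    In general the upper bound is uniform only on a set [G], and countably many
    such sets exhaust the space up to a null set. The estimate controls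
    the part of the annulus in the closure of [G]. If the annulus carries the
    proportion [eta] of the mass of [B(x, r)], then the proportion [eta / 2]
    lies outside this closure ([heavy_thin_point]). When this happens for
    arbitrarily small [r], the closed set fails to have density 1 at [x], and
    the density theorem says that almost no point of the set is of this kind
    ([thin_points_negligible]).

    The measure [mu] may be far from doubling, so the density theorem rests
    on a covering lemma of Besicovitch type for the balls of an arbitrary norm
    ([greedy_cover], [greedy_multiplicity]). Finite covers suffice, since the
    radii may be bounded below at first, and a greedy choice then
    terminates.

    All counting, of balls covering an annulus as of balls with a common point,
    uses finite codes of directions or positions ([radial_code],
    [box_code]) instead of volumes in dimension [d]. *)

Set Implicit Arguments.
Unset Strict Implicit.
Unset Printing Implicit Defensive.

Import Order.TTheory GRing.Theory Num.Theory numFieldNormedType.Exports.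

Local Open Scope classical_set_scope.
Local Open Scope ring_scope.

(** * Norms on row vectors *)

Section Norm.
Context {R : realType} {d : nat} (N : 'rV[R]_d -> R) (hN : is_norm N).
Implicit Types (x y z : 'rV[R]_d) (r : R).

Lemma is_normD x y : N (x + y) <= N x + N y.
Proof. by case: hN => h _ _; exact: h. Qed.

Lemma is_normZ (a : R) x : N (a *: x) = `|a| * N x.
Proof. by case: hN => _ h _; exact: h. Qed.

Lemma is_norm0 : N 0 = 0.
Proof. by rewrite -(scale0r 0) is_normZ normr0 mul0r. Qed.

Lemma is_normN x : N (- x) = N x.
Proof. by rewrite -scaleN1r is_normZ normrN1 mul1r. Qed.

Lemma is_norm_ge0 x : 0 <= N x.
Proof. by have := is_normD x (- x); rewrite subrr is_norm0 is_normN; lra. Qed.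

Lemma is_norm_gt0 x : x != 0 -> 0 < N x.
Proof.
move=> x0; rewrite lt_def is_norm_ge0 andbT; apply: contra_neq x0.
by case: hN => _ _; exact.
Qed.

Lemma is_norm_distC x y : N (x - y) = N (y - x).
Proof. by rewrite -opprB is_normN. Qed.

Lemma is_norm_dist z x y : N (x - y) <= N (x - z) + N (z - y).
Proof. by rewrite -[x - y](subrKA z) is_normD. Qed.

Lemma is_normB x y : N x - N y <= N (x - y).
Proof. by have := is_normD (x - y) y; rewrite subrK; lra. Qed.

Lemma is_norm_le_sup : exists2 C : R, 0 < C & forall x, N x <= C * `|x|.
Proof.
exists (1 + \sum_(i < d) N (delta_mx 0 i)) => [|x].
  by rewrite ltr_wpDr// sumr_ge0// => i _; exact: is_norm_ge0.
rewrite [in leLHS](row_sum_delta x) mulrDl mul1r mulr_suml.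
apply: (@le_trans _ _ (\sum_(i < d) N (x 0 i *: delta_mx 0 i))).
  elim/big_ind2 : _ => [||i _]; rewrite ?is_norm0//.
  by move=> u u' v v' uu' vv'; rewrite (le_trans (is_normD _ _))// lerD.
rewrite ler_wpDl// ler_sum// => i _; rewrite is_normZ mulrC.
rewrite ler_wpM2l ?is_norm_ge0// [leRHS]/Num.norm/= mx_normrE.
by apply: (le_trans _ (le_bigmax _ _ (0, i))).
Qed.

Lemma is_norm_continuous : continuous N.
Proof.
have [C C0 NC] := is_norm_le_sup.
move=> x; apply/(@cvgrPdist_le _ R _ (nbhs x)) => e e0; apply/nbhs_ballP.
exists (e / C) => [|y]; first exact: divr_gt0.
rewrite -ball_normE/= ltr_pdivlMr// mulrC => /ltW xy.
apply: le_trans (le_trans (NC _) xy); rewrite ler_norml is_normB andbT.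
by rewrite lerNl opprB is_norm_distC is_normB.
Qed.

(** Compactness of the unit sphere of the sup norm, on which [N] attains a
    positive minimum. *)
Lemma is_norm_ge_sup : exists2 c : R, 0 < c & forall x, c * `|x| <= N x.
Proof.
have [x0|/existsNP[x1 /eqP x1_neq0]] := pselect (forall x, x = 0).
  by exists 1 => // x; rewrite (x0 x) is_norm0 normr0 mulr0.
pose S := [set x : 'rV[R]_d | `|x| = 1].
have S0 : S !=set0.
  exists (`|x1|^-1 *: x1); rewrite /S/= normrZ normfV normr_id mulVf//.
  by rewrite normr_eq0.
have cS : compact S.
  apply: bounded_closed_compact.
    by exists 1; split=> // M M1 x /= ->; exact: ltW.
  rewrite (_ : S = (fun x => `|x|) @^-1` [set 1])//.
  by apply: closed_comp => [x _|]; [exact: norm_continuous|exact: closed_eq].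
have [c /[!inE] Sc cmin] :=
  compact_EVT_min S0 cS (continuous_subspaceT is_norm_continuous).
have c_neq0 : c != 0.
  by apply/eqP => c0; move: Sc; rewrite c0 /S/= normr0 => /esym/eqP; rewrite oner_eq0.
exists (N c) => [|x]; first exact: is_norm_gt0.
have [->|xn0] := eqVneq x 0; first by rewrite is_norm0 normr0 mulr0.
have nx0 : 0 < `|x| by rewrite normr_gt0.
have : N c <= N (`|x|^-1 *: x).
  apply: cmin; rewrite inE /S/= normrZ normfV normr_id mulVf//.
  by rewrite gt_eqF.
by rewrite is_normZ normfV normr_id mulrC ler_pdivlMr.
Qed.

Lemma closed_is_norm_ball x r : closed (closed_ball_ N x r).
Proof.
rewrite (_ : closed_ball_ N x r = (fun y => N (x - y)) @^-1` [set t | t <= r])//.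
apply: closed_comp => [y _|]; last exact: closed_le.
apply: (@continuous_comp _ _ _ (fun z => x - z) N) => /=.
  by apply: continuousB => //; exact: cst_continuous.
exact: is_norm_continuous.
Qed.

Lemma open_is_norm_ball x r : open [set y | N (x - y) < r].
Proof.
rewrite (_ : [set y | _] = (fun y => N (x - y)) @^-1` [set t | t < r])//.
apply: open_comp => [y _|]; last exact: open_lt.
apply: (@continuous_comp _ _ _ (fun z => x - z) N) => /=.
  by apply: continuousB => //; exact: cst_continuous.
exact: is_norm_continuous.
Qed.

Lemma closure_approx (G : set 'rV[R]_d) x e :
  closure G x -> 0 < e -> exists2 g, G g & N (x - g) < e.
Proof.
move=> Gx e0.
have [|g [Gg xg]] := Gx [set y | N (x - y) < e]; last by exists g.
apply: open_nbhs_nbhs; split; first exact: open_is_norm_ball.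
by rewrite /= subrr is_norm0.
Qed.

End Norm.

(** * Codes that recognise nearby vectors *)

Section Code.
Context {R : realType}.
Implicit Types (K n : nat) (t : R).

(** The one-dimensional ingredient of the codes below, which are maps to finite
    types with fibres of small diameter. Codes serve both to cover sets by few
    balls and, through the pigeonhole principle, to bound the size of separated
    families. *)
Definition cell K t : 'I_K.*2.+1 := inord (Num.truncn (K%:R * (t + 1))).

Lemma cell_close K t t' : `|t| <= 1 -> `|t'| <= 1 -> cell K t = cell K t' ->
  K%:R * `|t - t'| <= 1.
Proof.
have cellE s : `|s| <= 1 -> (cell K s)%:R <= K%:R * (s + 1) < (cell K s).+1%:R.
  rewrite ler_norml => /andP[s1 s2].
  have s0 : 0 <= K%:R * (s + 1) by rewrite mulr_ge0//; lra.
  rewrite inordK; first exact: truncn_itv.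
  rewrite ltnS -(@ler_nat R); have /andP[h _] := truncn_itv s0.
  rewrite (le_trans h)// -muln2 natrM ler_wpM2l//; lra.
move=> /cellE/andP[a b] /cellE/andP[a' b'] e; move: a' b'; rewrite -e => a' b'.
rewrite -[K%:R]normr_nat -normrM mulrBr ler_norml.
move: a b a' b'; rewrite -natr1 !mulrDr; lra.
Qed.

Definition box_code n K (u : 'rV[R]_n) : {ffun 'I_n -> 'I_K.*2.+1} :=
  [ffun j => cell K (u 0 j)].

Lemma coord_le_norm n (u : 'rV[R]_n) i : `|u 0 i| <= `|u|.
Proof.
rewrite [leRHS]/Num.norm/= mx_normrE.
exact: (le_trans _ (le_bigmax _ _ (0, i))).
Qed.

Lemma norm_le_coord n (u : 'rV[R]_n) (e : R) :
  0 <= e -> (forall i, `|u 0 i| <= e) -> `|u| <= e.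
Proof.
move=> e0 ue; rewrite [leLHS]/Num.norm/= mx_normrE; apply/bigmax_leP; split=> //.
by move=> [i j] _ /=; rewrite ord1.
Qed.

Lemma box_code_close n K (u u' : 'rV[R]_n) : `|u| <= 1 -> `|u'| <= 1 ->
  box_code K u = box_code K u' -> K%:R * `|u - u'| <= 1.
Proof.
move=> u1 u1' e; rewrite -[K%:R]normr_nat -normrZ; apply: norm_le_coord => // i.
rewrite !mxE normrM normr_nat; apply: cell_close.
- exact: le_trans (coord_le_norm _ _) u1.
- exact: le_trans (coord_le_norm _ _) u1'.
- by move/ffunP: e => /(_ i); rewrite !ffunE.
Qed.

Definition face n (w : 'rV[R]_n.+1) : 'I_n.+1 :=
  [arg max_(i > ord0) `|w 0 i|]%O.

Lemma norm_face n (w : 'rV[R]_n.+1) : `|w| = `|w 0 (face w)|.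
Proof.
apply/eqP; rewrite eq_le coord_le_norm andbT; apply: norm_le_coord => // i.
by rewrite /face; case: arg_maxP => // j _; exact.
Qed.

(** Radial projection maps the unit sphere of any norm onto the boundary of the
    unit cube, which has dimension [n] in dimension [n.+1]. The code records the
    facet met by the ray through [w] (a coordinate of largest modulus and its
    sign) and a grid cell in that facet, so that [K] subdivisions cost only
    of order [K ^ n] values. *)
Definition radial_code n K (w : 'rV[R]_n.+1) :
    'I_n.+1 * bool * {ffun 'I_n -> 'I_K.*2.+1} :=
  (face w, 0 <= w 0 (face w),
   [ffun j => cell K (`|w|^-1 * w 0 (lift (face w) j))]).

Lemma card_radial_code n K :
  #|{: 'I_n.+1 * bool * {ffun 'I_n -> 'I_K.*2.+1}}| =
  (n.+1 * 2 * K.*2.+1 ^ n)%N.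
Proof. by rewrite !card_prod card_ffun !card_ord card_bool. Qed.

Lemma radial_code_close_sup n K (w w' : 'rV[R]_n.+1) :
  w != 0 -> w' != 0 -> radial_code K w = radial_code K w' ->
  K%:R * `| `|w|^-1 *: w - `|w'|^-1 *: w'| <= 1.
Proof.
move=> w0 w0' [ef es ec].
have nw : `|w| != 0 by rewrite normr_eq0.
have nw' : `|w'| != 0 by rewrite normr_eq0.
rewrite -[K%:R]normr_nat -normrZ; apply: norm_le_coord => // i.
rewrite !mxE; case: (unliftP (face w) i) => [j|] ->; last first.
  suff -> : `|w|^-1 * w 0 (face w) = `|w'|^-1 * w' 0 (face w).
    by rewrite subrr mulr0 normr0.
  rewrite norm_face [X in _ = X^-1 * _]norm_face -ef.
  move: nw nw' es; rewrite !norm_face -ef !normr_eq0.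
  move=> a a' + ; case: ger0P => ha; case: ger0P => hb // _.
    by rewrite !mulVf.
  by rewrite !invrN !mulNr !mulVf.
have cl (v : 'rV[R]_n.+1) : v != 0 -> `| `|v|^-1 * v 0 (lift (face w) j)| <= 1.
  move=> v0; rewrite normrM normfV normr_id mulrC ler_pdivrMr ?normr_gt0//.
  by rewrite mul1r coord_le_norm.
rewrite normrM normr_nat; apply: cell_close; [exact: cl|exact: cl|].
by move/ffunP: ec => /(_ j); rewrite !ffunE -ef.
Qed.

(** Vectors with the same radial code point in directions at distance
    [O(1/K)]; the remaining part of their distance is the difference of their
    norms. *)
Lemma radial_code_close n (N : 'rV[R]_n.+1 -> R) : is_norm N ->
  exists2 C : R, 0 < C & forall K w w', (0 < K)%N ->
    radial_code K w = radial_code K w' -> N w <= N w' ->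
    N (w - w') <= N w' - N w + C / K%:R * N w.
Proof.
move=> hN; have [C C0 NC] := is_norm_le_sup hN.
have [c c0 Nc] := is_norm_ge_sup hN.
exists (2 * C / c) => [|K w w' K0 e ww']; first by rewrite divr_gt0// mulr_gt0.
have K0' : 0 < K%:R :> R by rewrite ltr0n.
have [->|w0] := eqVneq w 0.
  by rewrite (is_norm0 hN) sub0r (is_normN hN) mulr0 addr0 subr0.
have Nw := is_norm_gt0 hN w0.
have w0' : w' != 0.
  by apply: contraTneq ww' => ->; rewrite (is_norm0 hN) -ltNge.
have Nw' := is_norm_gt0 hN w0'.
have := radial_code_close_sup w0 w0' e.
set u := _ *: w; set u' := _ *: w'; move=> uu'.
have Nu : c <= N u.
  by have := Nc u; rewrite normrZ normfV normr_id mulVf ?normr_eq0// mulr1.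
have Nu0 : 0 < N u by exact: lt_le_trans Nu.
have wE : w = `|w| *: u by rewrite scalerA divff ?normr_eq0// scale1r.
have wE' : w' = `|w'| *: u' by rewrite scalerA divff ?normr_eq0// scale1r.
have NwE : N w = `|w| * N u by rewrite {1}wE (is_normZ hN) normr_id.
have NwE' : N w' = `|w'| * N u' by rewrite {1}wE' (is_normZ hN) normr_id.
have Nu0' : 0 < N u' by move: Nw'; rewrite NwE' pmulr_rgt0// normr_gt0.
clearbody u u'.
have Duu' : N (u - u') <= C / K%:R.
  by rewrite ler_pdivlMr// (le_trans (ler_wpM2r _ (NC _)))// -mulrA ger_pMr// mulrC.
(* Shrink w' to the norm of w in two steps: first replace u by u', then correct
   the length of the multiple of u'. *)
have -> : w - w' = `|w| *: (u - u') + (`|w| - N w / N u') *: u'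
    - (N w' / N u' - N w / N u') *: u'.
  rewrite [N w' / _](_ : _ = `|w'|); last by rewrite NwE' mulfK// gt_eqF.
  by rewrite {1}wE {1}wE' scalerBr !scalerBl opprB !subrKA.
rewrite addrC.
apply: le_trans (is_normD hN _ _) _; apply: lerD.
  rewrite (is_normN hN) (is_normZ hN) -mulrBl normrM normfV.
  by rewrite (gtr0_norm Nu0') divfK ?gt_eqF// ger0_norm// subr_ge0.
apply: le_trans (is_normD hN _ _) _; rewrite !(is_normZ hN) normr_id.
have -> : `|w| - N w / N u' = `|w| / N u' * (N u' - N u).
  by rewrite NwE; field; rewrite gt_eqF.
rewrite !normrM normr_id normfV (gtr0_norm Nu0') mulrAC divfK ?gt_eqF//.
have : `|N u' - N u| <= N (u - u').
  by rewrite ler_norml lerNl opprB (is_normB hN) (is_norm_distC hN) (is_normB hN).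
move=> D'; rewrite -mulrDr.
apply: (@le_trans _ _ (`|w| * (2 * C / K%:R))).
  by rewrite ler_wpM2l//; lra.
have -> : 2 * C / c / K%:R * N w = `|w| * (2 * C / K%:R) * (N u / c).
  by rewrite NwE; field; rewrite !gt_eqF.
by rewrite ler_peMr// ?ler_pdivlMr ?mul1r// !mulr_ge0// ltW// divr_gt0// mulr_gt0.
Qed.

End Code.

(** * A Besicovitch covering lemma *)

Section Besicovitch.
Context {R : realType}.

Lemma box_code_cover d (N : 'rV[R]_d -> R) : is_norm N ->
  exists2 C : R, 0 < C & forall (M : R) K, 0 < M -> (0 < K)%N ->
    exists code : 'rV[R]_d -> {ffun 'I_d -> 'I_K.*2.+1},
      forall x y, N x <= M -> N y <= M -> code x = code y ->
        N (x - y) <= C * M / K%:R.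
Proof.
move=> hN; have [C C0 NC] := is_norm_le_sup hN.
have [c c0 Nc] := is_norm_ge_sup hN.
exists (C / c) => [|M K M0 K0]; first exact: divr_gt0.
have K0' : 0 < K%:R :> R by rewrite ltr0n.
exists (fun x => box_code K ((c / M) *: x)) => x y xM yM.
have cM v : N v <= M -> `|(c / M) *: v| <= 1.
  move=> vM; rewrite normrZ gtr0_norm ?divr_gt0// mulrAC ler_pdivrMr// mul1r.
  exact: le_trans (Nc v) vM.
move=> /(box_code_close (cM _ xM) (cM _ yM)).
rewrite -scalerBr normrZ gtr0_norm ?divr_gt0// => h.
apply: (le_trans (NC _)).
have -> : C / c * M / K%:R = C * (M / (c * K%:R)).
  by field; rewrite !gt_eqF.
rewrite ler_pM2l// ler_pdivlMr ?mulr_gt0// mulrC.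
have -> : c * K%:R * `|x - y| = M * (K%:R * (c / M * `|x - y|)).
  by field; rewrite gt_eqF.
by rewrite ger_pMr.
Qed.

Lemma pairwise_code_size (T : eqType) (I : finType) (code : T -> I)
    (r : rel T) s :
  {in s &, forall x y, r x y -> code x != code y} -> pairwise r s ->
  (size s <= #|I|)%N.
Proof.
move=> rc ps; rewrite -(size_map code).
suff /card_uniqP <- : uniq (map code s) by exact: max_card.
rewrite uniq_pairwise pairwise_map; apply: (sub_in_pairwise rc _ ps).
exact/allP.
Qed.

Context {d : nat} (N : 'rV[R]_d -> R) (hN : is_norm N).

(** Boundedness enters [greedy_cover] through this bound, which makes the
    greedy selection stop. *)
Lemma separated_bounded (M a : R) : 0 < a ->
  exists n, forall s : seq 'rV[R]_d, (forall x, x \in s -> N x <= M) ->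
    pairwise (fun x y => a < N (x - y)) s -> (size s <= n)%N.
Proof.
move=> a0; have [C C0 hC] := box_code_cover hN.
pose L := Num.max M 1; have L0 : 0 < L by rewrite lt_max ltr01 orbT.
pose K := (Num.truncn (C * L / a)).+1.
have K0 : 0 < K%:R :> R by rewrite ltr0n.
have [code hcode] := hC L K L0 isT.
exists #|{ffun 'I_d -> 'I_K.*2.+1}| => s sM.
apply: (@pairwise_code_size _ _ code) => x y xs ys.
rewrite ltNge; apply: contraNN => /eqP.
have le_L z : z \in s -> N z <= L by move=> /sM zM; rewrite le_max zM.
move=> /(hcode _ _ (le_L _ xs) (le_L _ ys)) /le_trans; apply.
rewrite ler_pdivrMr// [a * _]mulrC -ler_pdivrMr//.
exact: ltW (truncnS_gt _).
Qed.

(** Here [x] is a centre chosen before [y]. A factor above 1 is needed because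
    the supremum of the radii of the remaining balls may not be attained;
    [9 / 8] is small enough for [greedy_multiplicity]. *)
Definition greedy (rho : 'rV[R]_d -> R) : rel 'rV[R]_d :=
  fun x y => (rho x < N (x - y)) && (rho y <= 9 / 8 * rho x).

(** Repeatedly select a ball of almost largest radius among those whose centre
    is not covered yet. The selected centres are [a]-separated and stay in a
    bounded set, hence the induction on the maximal number of separated points
    left. *)
Lemma greedy_cover (A : set 'rV[R]_d) (rho : 'rV[R]_d -> R) (a b M : R) :
  0 < a -> (forall x, A x -> N x <= M) -> (forall x, A x -> a <= rho x <= b) ->
  exists s, [/\ forall x, x \in s -> A x, pairwise (greedy rho) s
    & forall x, A x -> exists2 y, y \in s & N (y - x) <= rho y].
Proof.
move=> a0 AM Arho; have [n hn] := separated_bounded M a0.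
have {AM hn} : forall s : seq 'rV[R]_d, (forall x, x \in s -> A x) ->
    pairwise (fun x y => a < N (x - y)) s -> (size s <= n)%N.
  by move=> s sA; apply: hn => x /sA /AM.
elim: n A Arho => [|n ih] A Arho hA.
  exists [::]; split=> // x Ax.
  suff: (1 <= 0)%N by [].
  by apply: (hA [:: x]) => // y; rewrite inE => /eqP ->.
have [[x0 Ax0]|/forallNP A0] := pselect (A !=set0); last first.
  by exists [::]; split=> // x /A0.
have hs : has_sup (rho @` A).
  split; first by exists (rho x0), x0.
  by exists b => _ [x /Arho/andP[_ ?] <-].
have s0 : 0 < sup (rho @` A).
  have /andP[ax0 _] := Arho _ Ax0.
  by rewrite (lt_le_trans a0)// (le_trans ax0)// sup_upper_bound//; exists x0.
have [_ [x Ax <-] xs] : exists2 t, (rho @` A) t & 8 / 9 * sup (rho @` A) < t.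
  have e0 : 0 < 1 / 9 * sup (rho @` A) by lra.
  by have [t At ht] := sup_adherent e0 hs; exists t => //; lra.
have xmax y : A y -> rho y <= 9 / 8 * rho x.
  move=> Ay; have : rho y <= sup (rho @` A) by apply: sup_upper_bound => //; exists y.
  by lra.
pose A' := A `&` [set y | rho x < N (x - y)].
have [|t At pt|s [sA ps cs]] := ih A'; first by move=> y [/Arho].
- rewrite -ltnS; apply: (hA (x :: t)).
    by move=> y /predU1P[->//|/At[]].
  rewrite /= pt andbT; apply/allP => y /At[_ /=].
  by apply: le_lt_trans; have /andP[] := Arho _ Ax.
- exists (x :: s); split.
  + by move=> y /predU1P[->//|/sA[]].
  + rewrite /= ps andbT; apply/allP => y /sA[Ay xy].
    by rewrite /greedy xy xmax.
  + move=> y Ay; have [xy|xy] := leP (N (x - y)) (rho x).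
      by exists x => //; rewrite inE eqxx.
    have [|z zs zy] := cs y; first by split.
    by exists z => //; rewrite inE zs orbT.
Qed.

End Besicovitch.

(** The geometric heart of the covering lemma. Seen from a common point [z] of
    the selected balls, two centres in nearly the same direction would be so
    close that the later one lies in the ball of the earlier one. The argument
    fails only if the earlier centre is much closer to [z] than its radius; but
    if both centres are, then they are close to each other for that reason.
    So the direction of [y - z], up to a fixed precision, together with the
    truth value of [N (y - z) < rho y / 4], determines [y]. *)
Lemma greedy_multiplicity {R : realType} n (N : 'rV[R]_n.+1 -> R) : is_norm N ->
  exists M : nat, forall rho s (z : 'rV[R]_n.+1), pairwise (greedy N rho) s ->
    (count (fun y => N (y - z) <= rho y)%R s <= M)%N.
Proof.
move=> hN; have [C C0 hC] := radial_code_close hN.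
pose K := (Num.truncn (2 * C)).+1.
have K0 : 0 < K%:R :> R by rewrite ltr0n.
have CK : C / K%:R <= 1 / 2.
  have := truncnS_gt (2 * C); rewrite -/K => h.
  by rewrite ler_pdivrMr//; lra.
pose I := ('I_n.+1 * bool * {ffun 'I_n -> 'I_K.*2.+1} * bool)%type.
exists #|{: I}| => rho s z ps; rewrite -size_filter.
pose code y : I := (radial_code K (y - z), N (y - z) < rho y / 4).
apply: (@pairwise_code_size _ _ code (greedy N rho)); last first.
  exact: subseq_pairwise (filter_subseq _ _) ps.
move=> x y; rewrite !mem_filter => /andP[xz _] /andP[yz _] /andP[xy yx].
apply/eqP => exy; have eb := congr1 snd exy; have {}exy := congr1 fst exy.
rewrite /= in exy eb.
move: xy xz yz eb; rewrite -(subrKA z x (- y)) -(opprB y z).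
move: (x - z) (y - z) exy => w w' exy xy xz yz eb.
have w0 := is_norm_ge0 hN w; have w0' := is_norm_ge0 hN w'.
have [ww'|/ltW ww'] := leP (N w) (N w').
  have := hC K w w' isT exy ww'.
  have : C / K%:R * N w <= 1 / 2 * N w by rewrite ler_wpM2r.
  have := is_normD hN w (- w'); rewrite (is_normN hN).
  by move: eb; case: ltP => h /esym; case: ltP => // h' _; lra.
have := hC K w' w isT (esym exy) ww'.
have : C / K%:R * N w' <= 1 / 2 * N w' by rewrite ler_wpM2r.
by rewrite (is_norm_distC hN); lra.
Qed.

(** * Measure of covers *)

Section Covering.
Context {R : realType}.
Local Open Scope ereal_scope.

Lemma measure_bigsetU_le d (T : measurableType d) (mu : {measure set T -> \bar R})
    (I : Type) (s : seq I) (F : I -> set T) :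
  (forall i, measurable (F i)) ->
  mu (\big[setU/set0]_(i <- s) F i) <= \sum_(i <- s) mu (F i).
Proof.
move=> mF; elim: s => [|i s ih]; first by rewrite !big_nil measure0.
rewrite !big_cons; apply: le_trans (measureU2 _ _ _) _ => //.
  exact: bigsetU_measurable.
exact: leeD2l.
Qed.

(** Integrate the pointwise inequality between the sum of the indicators of the
    [F i] and [M] times the indicator of [U]. *)
Lemma sum_measure_multiplicity d (T : measurableType d)
    (mu : {measure set T -> \bar R}) (I : eqType) (s : seq I) (F : I -> set T)
    (U : set T) (M : nat) :
  (forall i, measurable (F i)) -> measurable U ->
  (forall i, i \in s -> F i `<=` U) ->
  (forall z, (count (fun i => z \in F i) s <= M)%N) ->
  \sum_(i <- s) mu (F i) <= M%:R%:E * mu U.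
Proof.
move=> mF mU FU FM.
have indicF i : mu (F i) = \int[mu]_x (\1_(F i) x)%:E.
  by rewrite integral_indic// setIT.
have mind (A : set T) : measurable A ->
    measurable_fun [set: T] (EFin \o (\1_A : T -> R)).
  by move=> mA; apply/measurable_EFinP; exact: measurable_indic.
rewrite (eq_bigr _ (fun i _ => indicF i)) -ge0_integral_sum//; last first.
  by move=> k; have := mind _ (mF k).
have -> : mu U = \int[mu]_x (\1_U x)%:E by rewrite integral_indic// setIT.
rewrite -ge0_integralZl//; last exact: (mind _ mU).
apply: ge0_le_integral => //.
- by move=> x _; apply: sume_ge0.
- by apply: emeasurable_sum => i; exact: (mind _ (mF i)).
- by apply: measurable_funeM; exact: (mind _ mU).
move=> z _.
have -> : \sum_(i <- s) (\1_(F i) z)%:E = (count (fun i => z \in F i) s)%:R%:E :> \bar R.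
  rewrite sumEFin -sum1_count natr_sum [in RHS]big_mkcond/=; congr EFin.
  by apply: eq_bigr => i _; rewrite indicE; case: (_ \in _).
rewrite -EFinM lee_fin indicE; case: (boolP (z \in U)) => zU.
  by rewrite mulr1 ler_nat.
rewrite mulr0 (_ : count _ _ = 0%N)//; apply/eqP; rewrite -leqn0 leqNgt -has_count.
apply/hasPn => i si; apply: contra zU; rewrite !inE; exact: FU.
Qed.

(** The [D m] need not be measurable, and their covers need not be increasing:
    the lower limit of the covers works. *)
Lemma increasing_cover d (T : measurableType d) (mu : {measure set T -> \bar R})
    (D : nat -> set T) (t : \bar R) :
  nondecreasing_seq D ->
  (forall m, exists V, [/\ measurable V, D m `<=` V & mu V <= t]) ->
  exists V, [/\ measurable V, \bigcup_m D m `<=` V & mu V <= t].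
Proof.
move=> ndD /choice[V hV].
(* The W m increase, and D m is contained in W m because D is increasing. *)
pose W m := \bigcap_(j in [set j | (m <= j)%N]) V j.
have mV m : measurable (V m) by have [] := hV m.
have mW m : measurable (W m) by apply: bigcap_measurable => // ; exists m => /=.
have mUW : measurable (\bigcup_m W m) by exact: bigcupT_measurable.
exists (\bigcup_m W m); split => //.
- move=> x [m _ Dx]; exists m => // j /= mj.
  have [_ + _] := hV j; apply.
  by move/subsetPset: (ndD _ _ mj); exact.
- have ndW : nondecreasing_seq W.
    move=> m m' mm'; apply/subsetPset => x Wx j /= m'j; apply: Wx => /=.
    exact: leq_trans m'j.
  have cW := nondecreasing_cvg_mu (mu := mu) mW mUW ndW.
  rewrite -(cvg_lim _ cW)//; apply: lime_le.
    by apply/cvg_ex; exists (mu (\bigcup_m W m)).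
  apply: nearW => m /=; have [_ _] := hV m; apply: le_trans.
  by apply: le_measure; rewrite ?inE// => x; apply => /=.
Qed.

End Covering.

Section BorelrV.
Context {R : realType} {d : nat}.

Lemma open_borel_rV (A : set 'rV[R]_d) : open A -> measurable (A : set (borel_rV R d)).
Proof. by move=> oA; exact: sub_sigma_algebra. Qed.

Lemma closed_borel_rV (A : set 'rV[R]_d) : closed A ->
  measurable (A : set (borel_rV R d)).
Proof.
move=> cA; rewrite -[A]setCK; apply: measurableC; apply: open_borel_rV.
exact: closed_openC.
Qed.

Context (N : 'rV[R]_d -> R) (hN : is_norm N).

Lemma ball_borel_rV x r : measurable (closed_ball_ N x r : set (borel_rV R d)).
Proof. by apply: closed_borel_rV; exact: closed_is_norm_ball. Qed.

(** Each fibre of the code is contained in the ball of radius [t] around any of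
    its points. *)
Lemma measure_code (mu : {measure set (borel_rV R d) -> \bar R})
    (S : set 'rV[R]_d) (I : finType) (code : 'rV[R]_d -> I) (t v : R) :
  measurable (S : set (borel_rV R d)) -> 0 <= v ->
  (forall y y', S y -> S y' -> code y = code y' -> N (y - y') <= t) ->
  (forall y, S y -> (mu (closed_ball_ N y t) <= v%:E)%E) ->
  (mu S <= (#|I|%:R * v)%:E)%E.
Proof.
move=> mS v0 code_le mu_le.
pose F (i : I) : set (borel_rV R d) :=
  if pselect (exists y, S y /\ code y = i) is left h
  then closed_ball_ N (projT1 (cid h)) t else set0.
have mF i : measurable (F i).
  by rewrite /F; case: pselect => // h; exact: ball_borel_rV.
have SF : S `<=` \big[setU/set0]_(i <- enum I) F i.
  move=> y Sy; rewrite -bigcup_seq; exists (code y); first by rewrite /= mem_enum.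
  rewrite /F; case: pselect => [h|]; last by case; exists y.
  by case: cid => y' [Sy' e] /=; rewrite /closed_ball_/=; exact: code_le.
apply: (@le_trans _ _ (mu (\big[setU/set0]_(i <- enum I) F i))).
  by apply: le_measure; rewrite ?inE//; apply: bigsetU_measurable.
apply: le_trans (measure_bigsetU_le _ _ mF) _.
apply: (@le_trans _ _ (\sum_(i <- enum I) v%:E)%E).
  apply: lee_sum => i _; rewrite /F; case: pselect => [h|]; last first.
    by rewrite measure0 lee_fin.
  by case: cid => y' [Sy' e] /=; exact: mu_le.
by rewrite sumEFin lee_fin big_const_seq iter_addr_0 count_predT -cardT mulr_natl.
Qed.

End BorelrV.

(** * A density theorem *)

Section Density.
Context {R : realType} {n : nat} (N : 'rV[R]_n.+1 -> R) (hN : is_norm N).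
Context (mu : probability (borel_rV R n.+1) R) (c : R) (c0 : 0 < c).
Local Open Scope ereal_scope.

Definition thin_ball (G : set 'rV[R]_n.+1) x r :=
  c%:E * mu (closed_ball_ N x r) <= mu (closed_ball_ N x r `\` G).

(** The weak-type estimate: by [greedy_cover] the centres of thin balls contained
    in [U] are covered by balls whose parts outside [G] overlap boundedly in
    [U `\` G], and these parts carry at least the proportion [c] of their mass.
    The bounds on the radii and the centres make the cover finite. *)
Lemma thin_ball_cover : exists K : R, (0 <= K)%R /\
  forall (G U : set 'rV[R]_n.+1) (a M : R),
  closed G -> measurable (U : set (borel_rV R n.+1)) -> (0 < a)%R ->
  exists V : set (borel_rV R n.+1), [/\ measurable V,
    [set x | (N x <= M)%R /\ exists r, [/\ (a <= r <= 1)%R,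
        closed_ball_ N x r `<=` U & thin_ball G x r]] `<=` V
  & mu V <= K%:E * mu (U `\` G)].
Proof.
have [K hK] := greedy_multiplicity hN.
exists (c^-1 * K%:R)%R; split; first by rewrite mulr_ge0// invr_ge0 ltW.
move=> G U a M cG mU a0; set D := [set x | _].
have mG : measurable (G : set (borel_rV R n.+1)) by exact: closed_borel_rV.
have /choice[rho hrho] : forall x, exists r, D x -> [/\ (a <= r <= 1)%R,
    closed_ball_ N x r `<=` U & thin_ball G x r].
  move=> x; have [[_ [r hr]]|nD] := pselect (D x); first by exists r.
  by exists 0%R.
have [||s [sD gs Ds]] := @greedy_cover _ _ _ hN D rho a 1%R M a0.
- by move=> x [].
- by move=> x /hrho[].
pose B x : set (borel_rV R n.+1) := closed_ball_ N x (rho x).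
have mB x : measurable (B x) by exact: ball_borel_rV.
have mBG x : measurable (B x `\` G) by exact: measurableD.
exists (\big[setU/set0]_(x <- s) B x); split.
- exact: bigsetU_measurable.
- by move=> x /Ds[y ys yx]; rewrite -bigcup_seq; exists y.
apply: le_trans (measure_bigsetU_le _ _ mB) _.
apply: (@le_trans _ _ (\sum_(x <- s) c^-1%:E * mu (B x `\` G))).
  rewrite big_seq [leRHS]big_seq; apply: lee_sum => x /sD/hrho[_ _].
  by rewrite /thin_ball muleC -lee_pdivlMr// [in leRHS]muleC.
rewrite -ge0_sume_distrr// EFinM -muleA; apply: lee_wpmul2l.
  by rewrite lee_fin invr_ge0 ltW.
apply: sum_measure_multiplicity => //.
- exact: measurableD.
- by move=> x /sD/hrho[_ BU _] y [By Gy]; split => //; exact: BU.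
- move=> z; apply: leq_trans (hK rho s z gs).
  by apply: sub_count => x; rewrite inE => -[].
Qed.

End Density.

Section DensityTheorem.
Context {R : realType} {n : nat} (N : 'rV[R]_n.+1 -> R) (hN : is_norm N).
Context (mu : probability (borel_rV R n.+1) R) (c : R) (c0 : 0 < c).
Implicit Types (G : set 'rV[R]_n.+1).

(** For points of the support of [mu], the second condition forces the lower
    density of [G] to be at most [1 - c]. *)
Definition thin_points G : set 'rV[R]_n.+1 :=
  [set x | G x /\ forall e : R, 0 < e -> exists2 r, 0 < r < e & thin_ball N mu c G x r].

Definition inv_nbhd G k : set 'rV[R]_n.+1 :=
  \bigcup_(g in G) [set y | N (g - y) < k.+1%:R^-1].

Lemma open_inv_nbhd G k : open (inv_nbhd G k).
Proof. by apply: bigcup_open => g _; exact: open_is_norm_ball. Qed.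

Lemma measure_inv_nbhdD_cvg0 G : closed G ->
  (mu (inv_nbhd G k `\` G : set (borel_rV R n.+1)) @[k --> \oo] --> 0)%E.
Proof.
move=> cG; have mG : measurable (G : set (borel_rV R n.+1)) by exact: closed_borel_rV.
pose F k : set (borel_rV R n.+1) := inv_nbhd G k `\` G.
have mF k : measurable (F k).
  by apply: measurableD => //; apply: open_borel_rV; exact: open_inv_nbhd.
have capF : \bigcap_k F k = set0.
  rewrite -subset0 => y hy; have [_] := hy 0%N I; apply; apply: cG => V yV.
  have [e e0 eV] : exists2 e : R, 0 < e & forall g, N (y - g) < e -> V g.
    have [c' c'0 Nc] := is_norm_ge_sup hN.
    have [e/= e0 eV] := (nbhs_ballP y V).1 yV.
    exists (c' * e) => [|g yg]; first exact: mulr_gt0.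
    apply: eV; rewrite -ball_normE/= -(ltr_pM2l c'0).
    exact: le_lt_trans (Nc _) yg.
  have [[g Gg gy] _] := hy (Num.truncn e^-1) I.
  exists g; split => //; apply: eV; rewrite (is_norm_distC hN) (lt_trans gy)//.
  by rewrite invf_plt ?posrE// truncnS_gt.
rewrite -(measure0 mu) -capF; apply: nonincreasing_cvg_mu => //.
- exact: le_lt_trans (probability_le1 _ (mF _)) (ltry _).
- by rewrite capF.
- move=> k k' kk'; apply/subsetPset => y [[g Gg gy] nGy]; split => //.
  exists g => //=; apply: lt_le_trans gy _.
  by rewrite lef_pV2 ?posrE// ler_nat.
Qed.

(** Lebesgue's density theorem for the balls of [N]. Thin balls with small radius
    stay in a small neighbourhood of [G], so [thin_ball_cover] bounds the
    measure of the thin points by a multiple of that of the neighbourhood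
    minus [G], which tends to 0 because [G] is closed. *)
Lemma thin_points_negligible G : closed G -> mu.-negligible (thin_points G).
Proof.
move=> cG; have [K [K0 hK]] := thin_ball_cover hN mu c0.
have {hK} /choice[V hV] : forall k, exists V : set (borel_rV R n.+1),
    [/\ measurable V, thin_points G `<=` V & (mu V <= K%:E * mu (inv_nbhd G k `\` G))%E].
  move=> k.
  pose D m := [set x | (N x <= m%:R) /\ exists r, [/\ m.+1%:R^-1 <= r <= 1,
        closed_ball_ N x r `<=` inv_nbhd G k & thin_ball N mu c G x r]].
  have [||V [mV DV muV]] := @increasing_cover _ _ _ mu D (K%:E * mu (inv_nbhd G k `\` G)).
  - move=> m m' mm'; apply/subsetPset => x [xm [r [/andP[mr r1] xr thin]]].
    split; first by rewrite (le_trans xm)// ler_nat.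
    exists r; split => //; rewrite r1 andbT (le_trans _ mr)//.
    by rewrite lef_pV2 ?posrE// ler_nat.
  - move=> m; apply: hK => //.
    by apply: open_borel_rV; exact: open_inv_nbhd.
  exists V; split => //; apply: subset_trans DV => x [Gx].
  have e0 : 0 < Num.min 1 k.+1%:R^-1 :> R by rewrite lt_min ltr01 invr_gt0 ltr0Sn.
  move=> /(_ _ e0)[r /andP[r0]]; rewrite lt_min => /andP[r1 rk] thin.
  exists (maxn (Num.truncn (N x)).+1 (Num.truncn r^-1).+1) => //; split.
    by rewrite (le_trans (ltW (truncnS_gt (N x))))// ler_nat leq_maxl.
  exists r; split => //.
  - rewrite (ltW r1) andbT invf_ple ?posrE//.
    rewrite (le_trans (ltW (truncnS_gt r^-1)))// ler_nat.
    by rewrite (leq_trans _ (leqnSn _))// leq_maxr.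
  - by move=> y xy; exists x => //=; exact: le_lt_trans xy rk.
have mA : measurable (\bigcap_k V k).
  by apply: bigcapT_measurable => k; have [] := hV k.
exists (\bigcap_k V k); split => //; last by move=> x tx k _; have [_ + _] := hV k; exact.
apply/eqP; rewrite -measure_le0.
have cv : (K%:E * mu (inv_nbhd G k `\` G : set (borel_rV R n.+1))
    @[k --> \oo] --> K%:E * 0)%E.
  by apply: cvgeZl => //; exact: measure_inv_nbhdD_cvg0.
rewrite mule0 in cv; rewrite -(cvg_lim _ cv)//; apply: lime_ge.
  by apply/cvg_ex; exists 0%E.
apply: nearW => k; have [mV _] := hV k; apply: le_trans.
by apply: le_measure; rewrite ?inE// => x; apply.
Qed.

End DensityTheorem.

(** * Mass of thin annuli *)

Section MassBounds.
Context {R : realType} {n : nat} (N : 'rV[R]_n.+1 -> R) (hN : is_norm N).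
Context (mu : probability (borel_rV R n.+1) R).
Implicit Types (G : set 'rV[R]_n.+1) (x y : 'rV[R]_n.+1) (alpha beta rho r s t : R).

Definition mass_le alpha rho : set 'rV[R]_n.+1 :=
  [set x | forall r, 0 < r < rho -> (mu (closed_ball_ N x r) <= (r `^ alpha)%:E)%E].

Definition mass_ge beta rho : set 'rV[R]_n.+1 :=
  [set x | forall r, 0 < r < rho -> ((r `^ beta)%:E <= mu (closed_ball_ N x r))%E].

Lemma le_ball_borel_rV x r (A : set (borel_rV R n.+1)) :
  measurable A -> A `<=` closed_ball_ N x r -> (mu A <= mu (closed_ball_ N x r))%E.
Proof.
by move=> mA Ax; apply: le_measure; rewrite ?inE//; exact: ball_borel_rV.
Qed.

(** Passing to the closure of [G], which is measurable, costs only an enlargement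
    of the radius. *)
Lemma mass_le_closure alpha rho G y s t : G `<=` mass_le alpha rho ->
  closure G y -> 0 <= t -> 0 < s -> t + s < rho ->
  (mu (closed_ball_ N y t) <= ((t + s) `^ alpha)%:E)%E.
Proof.
move=> Gle Gy t0 s0 ts.
have [g Gg yg] := closure_approx hN Gy s0.
apply: le_trans (Gle g Gg (t + s) _); last by rewrite ts andbT ltr_wpDl.
apply: le_ball_borel_rV; first exact: ball_borel_rV.
move=> z yz; rewrite /closed_ball_/= [t + s]addrC.
apply: le_trans (is_norm_dist hN y g z) _; apply: lerD => //.
by rewrite (is_norm_distC hN) ltW.
Qed.

(** An annulus of radius [r] and width [s] is covered by about [(r / s) ^ n]
    balls of radius comparable to [s], because a sphere in dimension [n.+1] has
    dimension [n]. Only balls that meet [closure G] count, and each of them has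
    mass at most of order [s `^ alpha]. *)
Lemma thin_annulus_mass : exists A B : R, [/\ 0 < A, 0 < B &
  forall alpha rho G x r s, G `<=` mass_le alpha rho ->
    0 < s <= r -> B * s < rho ->
    (mu ((closed_ball_ N x r `\` closed_ball_ N x (r - s)) `&` closure G)
      <= (A * (r / s) ^+ n * (B * s) `^ alpha)%:E)%E].
Proof.
have [C C0 hC] := radial_code_close hN.
exists ((n.+1 * 2)%:R * 5 ^+ n), (2 + C); split.
- by rewrite mulr_gt0// exprn_gt0.
- by rewrite addr_gt0.
move=> alpha rho G x r s Gle /andP[s0 sr] Bs.
pose K := (Num.truncn (r / s)).+1.
have K0 : 0 < K%:R :> R by rewrite ltr0n.
have rs1 : 1 <= r / s by rewrite ler_pdivlMr// mul1r.
have rsK : r / s <= K%:R by exact: ltW (truncnS_gt _).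
have Krs : K.*2.+1%:R <= 5 * (r / s).
  have /andP[+ _] := truncn_itv (le_trans ler01 rs1).
  by rewrite -natr1 -muln2 natrM /K -[_.+1%:R]natr1; lra.
set S := _ `&` _.
have mS : measurable (S : set (borel_rV R n.+1)).
  apply: measurableI; last by apply: closed_borel_rV; exact: closed_closure.
  by apply: measurableD; exact: ball_borel_rV.
have t0 : 0 <= s + C * s by rewrite addr_ge0// ltW// mulr_gt0.
apply: le_trans (measure_code hN (code := fun y => radial_code K (y - x))
  (t := s + C * s) (v := ((2 + C) * s) `^ alpha) mS (powR_ge0 _ _) _ _) _.
- wlog yy' : / forall y y', S y -> S y' ->
      radial_code K (y - x) = radial_code K (y' - x) ->
      N (y - x) <= N (y' - x) -> N (y - y') <= s + C * s.
    apply; move=> y y' [[xy /negP nxy] _] [[xy' /negP nxy'] _] e le.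
    have -> : y - y' = (y - x) - (y' - x) by rewrite opprB subrKA.
    apply: le_trans (hC K _ _ isT e le) _; apply: lerD.
      move: xy' nxy; rewrite /closed_ball_/= !(is_norm_distC hN x) -ltNge; lra.
    rewrite -mulrA ler_pM2l// mulrC ler_pdivrMr// mulrC -ler_pdivrMr//.
    apply: le_trans rsK; rewrite ler_pM2r ?invr_gt0//.
    by move: xy; rewrite /closed_ball_/= (is_norm_distC hN x).
  move=> y y' Sy Sy' e; have [le|/ltW le] := leP (N (y - x)) (N (y' - x)).
    exact: yy'.
  by rewrite (is_norm_distC hN); exact: yy'.
- move=> y [_ Gy]; have -> : (2 + C) * s = s + C * s + s by ring.
  apply: (mass_le_closure Gle Gy) => //; first by apply: le_lt_trans Bs; lra.
rewrite lee_fin card_radial_code ler_wpM2r ?powR_ge0//.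
rewrite natrM -mulrA ler_pM2l ?ltr0n// -exprMn natrX.
have rs0 := le_trans ler01 rs1.
by apply: lerXn2r; rewrite ?nnegrE ?(mulr_ge0 _ rs0).
Qed.

(** A bounded set is covered by about [K ^ n.+1] balls of radius of order [1 / K],
    and with exponent [n.+2] their total mass is [O(1 / K)]. *)
Lemma mass_le_supercritical rho : 0 < rho ->
  mu (closure (mass_le n.+2%:R rho)) = 0%E.
Proof.
move=> rho0; set G := mass_le _ _.
have mG : measurable (closure G : set (borel_rV R n.+1)).
  by apply: closed_borel_rV; exact: closed_closure.
have [C C0 hC] := box_code_cover hN.
pose S m : set (borel_rV R n.+1) := closure G `&` closed_ball_ N 0 m.+1%:R.
have mS m : measurable (S m).
  by apply: measurableI => //; exact: ball_borel_rV.
suff S0 m : mu (S m) = 0%E.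
  apply/eqP; rewrite -measure_le0; apply: (@le_trans _ _ (\sum_(m <oo) mu (S m))%E).
    apply: measure_sigma_subadditive => // x Gx.
    exists (Num.truncn (N x)) => //; split => //=.
    by rewrite /closed_ball_/= sub0r (is_normN hN) ltW// truncnS_gt.
  by rewrite eseries0// => i _ _; exact: S0.
apply/eqP; rewrite -measure_le0; apply/lee_addgt0Pr => e e0; rewrite add0e.
pose D := 2 * (C * m.+1%:R); pose Q := 3 ^+ n.+1 * D ^+ n.+2.
have D0 : 0 < D by rewrite !mulr_gt0.
have Q0 : 0 < Q by rewrite mulr_gt0// exprn_gt0.
pose K := (Num.truncn (Num.max (Q / e) (D / rho))).+1.
have K0 : 0 < K%:R :> R by rewrite ltr0n.
have := truncnS_gt (Num.max (Q / e) (D / rho)).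
rewrite -/K gt_max => /andP[QK DK].
have [code hcode] := hC m.+1%:R K (ltr0Sn _ _) isT.
apply: le_trans (measure_code hN (code := code)
  (t := C * m.+1%:R / K%:R) (v := (D / K%:R) `^ n.+2%:R) (mS m) (powR_ge0 _ _) _ _) _.
- move=> y y' [_ y0] [_ y0']; apply: hcode.
    by move: y0; rewrite /closed_ball_/= sub0r (is_normN hN).
  by move: y0'; rewrite /closed_ball_/= sub0r (is_normN hN).
- move=> y [Gy _].
  have -> : D / K%:R = C * m.+1%:R / K%:R + C * m.+1%:R / K%:R.
    by rewrite /D; field; rewrite gt_eqF.
  apply: (mass_le_closure (@subset_refl _ G) Gy).
  + by rewrite divr_ge0// mulr_ge0// ltW.
  + by rewrite divr_gt0// mulr_gt0.
  + move: DK; rewrite ltr_pdivrMr// => DK.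
    by rewrite -mulrDl ltr_pdivrMr// mulrC; move: DK; rewrite /D; lra.
rewrite lee_fin card_ffun !card_ord powR_mulrn; last by rewrite divr_ge0// ltW.
apply: (@le_trans _ _ ((3 * K%:R) ^+ n.+1 * (D / K%:R) ^+ n.+2)).
  apply: ler_wpM2r; first by rewrite exprn_ge0// divr_ge0// ltW.
  rewrite natrX; apply: lerXn2r; rewrite ?nnegrE ?mulr_ge0//.
  have : 1 <= K%:R :> R by rewrite ler1n.
  by rewrite -natr1 -muln2 natrM; lra.
rewrite exprMn expr_div_n [K%:R ^+ n.+2]exprS invfM mulrACA.
have -> : 3 ^+ n.+1 * D ^+ n.+2 * (K%:R ^+ n.+1 * (K%:R^-1 * (K%:R ^+ n.+1)^-1)) = Q / K%:R.
  by rewrite /Q; field; rewrite expf_neq0 gt_eqF.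
by rewrite ler_pdivrMr// mulrC -ler_pdivrMr// ltW.
Qed.

End MassBounds.

(** * Comparing the exponents *)

Section Exponents.
Context {R : realType} {n : nat} (N : 'rV[R]_n.+1 -> R) (hN : is_norm N).
Context (mu : probability (borel_rV R n.+1) R).
Implicit Types (x : 'rV[R]_n.+1) (alpha beta rho : R).

Definition lower_exponent alpha :=
  {ae mu, forall x, exists2 r0 : R, 0 < r0 & mass_le N mu alpha r0 x}.

Definition upper_exponent beta :=
  {ae mu, forall x, exists2 r0 : R, 0 < r0 & mass_ge N mu beta r0 x}.

(** For small [r] the part of a heavy annulus in the closure has mass at most
    [O(r `^ (n + delta * (alpha - n)))] by [thin_annulus_mass] with
    [s = r `^ delta], which is negligible compared with [r `^ beta], hence with
    the mass of the ball. So at least half of the mass that makes the annulus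
    heavy lies outside the closure. *)
Lemma heavy_thin_point alpha beta rho delta eta x :
  0 < eta -> 1 <= delta -> beta < n%:R + delta * (alpha - n%:R) ->
  0 < rho -> mass_le N mu alpha rho x -> mass_ge N mu beta rho x ->
  heavy_annuli_set N mu delta eta x ->
  thin_points N mu (eta / 2) (closure (mass_le N mu alpha rho)) x.
Proof.
move=> eta0 delta1 hbeta rho0 xle xge [r_ [r01 r_cvg heavy]].
set G := mass_le _ _ _ _; split; first exact: subset_closure.
move=> e e0; have [A [B [A0 B0 thinAB]]] := thin_annulus_mass hN mu.
(* The excess of the exponent of the annulus over that of the ball. *)
pose kappa := n%:R + delta * (alpha - n%:R) - beta.
have kappa0 : 0 < kappa by rewrite subr_gt0.
pose Q := A * B `^ alpha; have Q0 : 0 < Q by rewrite mulr_gt0// powR_gt0.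
have etaQ : 0 < eta / 2 / Q by rewrite !divr_gt0.
(* Below r1, the power r `^ kappa absorbs the constant Q. *)
pose r1 := (eta / 2 / Q) `^ kappa^-1; have r10 : 0 < r1 by rewrite powR_gt0.
have tau0 : 0 < Num.min (Num.min e rho) (Num.min r1 (rho / B)).
  by rewrite !lt_min e0 rho0 r10 divr_gt0.
have /cvgrPdist_lt/(_ _ tau0)[k _ /(_ k (leqnn k))/=] := r_cvg.
have {r01} := r01 k; have {heavy} := heavy k; move: (r_ k) => r heavy /andP[r0 lt_r1].
rewrite sub0r normrN (gtr0_norm r0) !lt_min => /andP[/andP[re rrho] /andP[rr1 rB]].
exists r; first by rewrite r0.
have rn0 : r != 0 by rewrite gt_eqF.
pose s := r `^ delta; have s0 : 0 < s by rewrite powR_gt0.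
have sr : s <= r by apply: ge1r_powR => //; rewrite r0 ltW.
have Bs : B * s < rho.
  apply: (le_lt_trans (ler_wpM2l (ltW B0) sr)).
  by rewrite mulrC -ltr_pdivlMr.
have mB := ball_borel_rV hN x r.
have mcG : measurable (closure G : set (borel_rV R n.+1)).
  by apply: closed_borel_rV; exact: closed_closure.
have mA : measurable (annulus N x r delta : set (borel_rV R n.+1)).
  by apply: measurableD => //; exact: ball_borel_rV.
have massA : (mu (annulus N x r delta `&` closure G)
    <= (eta / 2)%:E * mu (closed_ball_ N x r))%E.
  have s0r : 0 < s <= r by rewrite s0.
  apply: le_trans (thinAB alpha rho G x r s (@subset_refl _ G) s0r Bs) _.
  apply: (@le_trans _ _ ((eta / 2) * r `^ beta)%:E); last first.
    rewrite EFinM; apply: lee_wpmul2l; first by rewrite lee_fin divr_ge0// ltW.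
    by apply: xge; rewrite r0.
  have -> : A * (r / s) ^+ n * (B * s) `^ alpha = Q * r `^ kappa * r `^ beta.
    have -> : r / s = r `^ (1 - delta).
      by rewrite powRB ?rn0 ?implybT// powRr1 ?ltW.
    rewrite powRM ?ltW// /s -powRrM -powR_mulrn ?powR_ge0// -powRrM.
    rewrite -[RHS]mulrA -powRD; last by rewrite rn0 implybT.
    have -> : kappa + beta = (1 - delta) * n%:R + delta * alpha.
      by rewrite /kappa; ring.
    by rewrite powRD; [rewrite /Q; ring|rewrite rn0 implybT].
  rewrite lee_fin ler_wpM2r ?powR_ge0// mulrC -ler_pdivlMr//.
  apply: (@le_trans _ _ (r1 `^ kappa)).
    by apply: ge0_ler_powR; rewrite ?nnegrE ltW.
  by rewrite -powRrM mulVf ?gt_eqF// powRr1// ltW.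
have massD : (mu (annulus N x r delta `\` closure G)
    <= mu (closed_ball_ N x r `\` closure G))%E.
  apply: le_measure; rewrite ?inE; [exact: measurableD|exact: measurableD|].
  by move=> y [[]].
have {heavy} : (eta%:E * mu (closed_ball_ N x r) <= mu (annulus N x r delta))%E := heavy.
rewrite /thin_ball (measureDI mu mA mcG) => /le_trans/(_ (leeD massD massA)).
rewrite -(fineK (fin_num_measure mu _ mB)).
rewrite -(fineK (fin_num_measure mu _ (measurableD mB mcG))).
by rewrite -!EFinM -EFinD !lee_fin; lra.
Qed.

(** Almost every point satisfies both mass bounds up to some radius
    [m.+1%:R^-1], so countably many closed sets suffice. *)
Lemma heavy_annuli_negligible alpha beta delta eta :
  0 < eta -> 1 <= delta -> beta < n%:R + delta * (alpha - n%:R) ->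
  lower_exponent alpha -> upper_exponent beta ->
  mu.-negligible (heavy_annuli_set N mu delta eta).
Proof.
move=> eta0 delta1 hbeta lalpha ubeta.
pose G m := closure (mass_le N mu alpha m.+1%:R^-1).
have nG : mu.-negligible (\bigcup_m thin_points N mu (eta / 2) (G m)).
  apply: negligible_bigcup => m; apply: thin_points_negligible => //.
    exact: divr_gt0.
  exact: closed_closure.
apply: negligibleS (negligibleU (negligibleU lalpha ubeta) nG) => x heavy.
have [[ra ra0 hra]|] := pselect
    (exists2 r0 : R, 0 < r0 & mass_le N mu alpha r0 x);
  last by left; left.
have [[rb rb0 hrb]|] := pselect
    (exists2 r0 : R, 0 < r0 & mass_ge N mu beta r0 x);
  last by left; right.
right; pose r := Num.min ra rb; have r0 : 0 < r by rewrite lt_min ra0.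
exists (Num.truncn r^-1) => //.
have : (Num.truncn r^-1).+1%:R^-1 < r by rewrite invf_plt ?posrE// truncnS_gt.
rewrite lt_min => /andP[ta tb]; apply: heavy_thin_point hbeta _ _ _ heavy => //.
  by move=> t /andP[t0 /lt_trans tr]; apply: hra; rewrite t0 tr.
by move=> t /andP[t0 /lt_trans tr]; apply: hrb; rewrite t0 tr.
Qed.

Lemma setT_not_negligible : ~ mu.-negligible (setT : set (borel_rV R n.+1)).
Proof.
move=> /(negligibleP mu measurableT) h; have muT0 : mu setT = 0%E := h.
by have /eqP := probability_setT mu; rewrite muT0 eq_sym onee_eq0.
Qed.

Lemma lower_le_upper_exponent alpha beta :
  lower_exponent alpha -> upper_exponent beta -> alpha <= beta.
Proof.
move=> lalpha ubeta; rewrite leNgt; apply/negP => ba; apply: setT_not_negligible.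
apply: negligibleS (negligibleU lalpha ubeta) => x _.
apply/not_andP => -[[ra ra0 hra] [rb rb0 hrb]].
pose m := Num.min (Num.min ra rb) 1.
have m0 : 0 < m by rewrite !lt_min ra0 rb0 ltr01.
have r0 : 0 < m / 2 by rewrite divr_gt0.
have : m / 2 < m by rewrite ltr_pdivrMr// ltr_pMr// ltr1n.
rewrite {2}/m !lt_min => /andP[/andP[rra rrb] r1].
have := le_trans (hrb (m / 2) _) (hra (m / 2) _); rewrite r0 rra rrb => /(_ isT isT).
rewrite lee_fin leNgt => /negP; apply.
by rewrite /powR gt_eqF// ltr_expR ltr_nM2r// ln_lt0// r0.
Qed.

(** This rules out an infinite lower dimension, in which case the quotient of
    extended reals in [theorem1p3] would be 0 and carry no information. *)
Lemma lower_exponent_lt alpha : lower_exponent alpha -> alpha < n.+2%:R.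
Proof.
move=> lalpha; rewrite ltNge; apply/negP => nalpha.
apply: setT_not_negligible.
have nG : mu.-negligible (\bigcup_m closure (mass_le N mu n.+2%:R m.+1%:R^-1)).
  apply: negligible_bigcup => m; apply/negligibleP.
    by apply: closed_borel_rV; exact: closed_closure.
  by apply: mass_le_supercritical.
apply: negligibleS (negligibleU lalpha nG) => x _.
have [[ra ra0 hra]|] := pselect
    (exists2 r0 : R, 0 < r0 & mass_le N mu alpha r0 x);
  last by left.
right; exists (Num.truncn ra^-1) => //; apply: subset_closure => r /andP[r0 rt].
have tra : (Num.truncn ra^-1).+1%:R^-1 < ra by rewrite invf_plt ?posrE// truncnS_gt.
apply: le_trans (hra r _) _; first by rewrite r0 (lt_trans rt).
rewrite lee_fin; apply: ger_powR => //; rewrite r0 (le_trans (ltW rt))//.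
by rewrite invf_le1// ler1n.
Qed.

(** Both dimensions are finite, and the strict inequality on [delta] leaves room to
    replace them by admissible exponents close to them. That [delta] is at
    least 1 comes from the lower dimension not exceeding the upper one. *)
Lemma dim_exponents delta :
  (n%:R%:E < lower_dim N mu)%E ->
  ((upper_dim N mu - n%:R%:E) / (lower_dim N mu - n%:R%:E) < delta%:E)%E ->
  exists alpha beta, [/\ lower_exponent alpha, upper_exponent beta,
    1 <= delta & beta < n%:R + delta * (alpha - n%:R)].
Proof.
rewrite /lower_dim /upper_dim; set SL := [set _ | _ in _]; set SU := [set _ | _ in _].
move=> nL.
have LU : (ereal_sup SL <= ereal_inf SU)%E.
  apply: ge_ereal_sup => _ [alpha [_ la] <-].
  apply: le_ereal_inf_tmp => _ [beta [_ ub] <-].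
  by rewrite lee_fin; exact: lower_le_upper_exponent.
have Lfin : (ereal_sup SL <= n.+2%:R%:E)%E.
  apply: ge_ereal_sup => _ [alpha [_ la] <-].
  by rewrite lee_fin ltW//; exact: lower_exponent_lt.
case El : (ereal_sup SL) Lfin nL LU => [l| |]// _; rewrite lte_fin => nl.
have inv_l : ((l%:E - n%:R%:E)^-1 = (l - n%:R)^-1%:E)%E.
  by rewrite -EFinB inver subr_eq0 gt_eqF.
case Eu : (ereal_inf SU) => [u| |]//; rewrite inv_l; last first.
  by rewrite addye// gt0_mulye// lte_fin invr_gt0 subr_gt0.
rewrite lee_fin -EFinB -EFinM lte_fin ltr_pdivrMr ?subr_gt0// => lu hdelta.
have delta1 : 1 < delta.
  have : l - n%:R < delta * (l - n%:R) by apply: le_lt_trans hdelta; rewrite lerD2r.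
  by rewrite ltr_pMl ?subr_gt0.
have delta0 : 0 < delta by exact: lt_trans delta1.
(* Half of the room is spent on each of the two exponents. *)
pose sigma := (delta * (l - n%:R) - (u - n%:R)) / 2.
have sigma0 : 0 < sigma by rewrite divr_gt0// subr_gt0.
have [_ [alpha [_ la] <-]] : exists2 y, SL y & ((l - sigma / delta)%:E < y)%E.
  by apply: ereal_sup_gt; rewrite El lte_fin gtrBl divr_gt0.
rewrite lte_fin => hl.
have [_ [beta [_ ub] <-]] : exists2 y, SU y & (y < (u + sigma)%:E)%E.
  by apply: ereal_inf_lt; rewrite Eu lte_fin ltrDl.
rewrite lte_fin => hu; exists alpha, beta; split => //; first exact: ltW.
have : delta * (l - sigma / delta) < delta * alpha by rewrite ltr_pM2l.
have -> : delta * (l - sigma / delta) = delta * l - sigma.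
  by field; rewrite gt_eqF.
move: hu; rewrite /sigma !mulrBr; lra.
Qed.

End Exponents.

Theorem theorem1p3 (R : realType) (d : nat) (N : 'rV[R]_d -> R)
    (mu : probability (borel_rV R d) R) :
  (1 <= d)%N -> is_norm N -> is_radon mu ->
  ((d%:R - 1)%:E < lower_dim N mu)%E ->
  forall delta eta : R,
  ((upper_dim N mu - (d%:R - 1)%:E) / (lower_dim N mu - (d%:R - 1)%:E)
     < delta%:E)%E ->
  0 < eta <= 1 ->
  mu.-negligible (heavy_annuli_set N mu delta eta).
Proof.
case: d N mu => [//|n] N mu _ hN _; rewrite -natr1 addrK => nL delta eta hdelta.
move=> /andP[eta0 _].
have [alpha [beta [la ub delta1 hbeta]]] := dim_exponents hN nL hdelta.
exact: heavy_annuli_negligible la ub.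
Qed.
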